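(* Let $$\tau_{MM}(\mathbf t)=\sum_{\lambda\in DP}\left(\frac{\hbar}{16}\right)^{|\lambda|/3}2^{-l(\lambda)}\,\frac{Q_\lambda(\delta_{k,1})\,Q_{2\lambda}(\delta_{k,3}/3)}{Q_{2\lambda}(\delta_{k,1})}\,Q_\lambda(\mathbf t),$$ where $DP$ is the set of strict partitions. Then $\tau_{MM}(\mathbf t/2)$ is a hypergeometric tau function of the BKP hierarchy.
   Context: Variables: $\mathbf t=(t_1,t_3,t_5,\dots)$; $\hbar$ is a formal parameter; $\mathbf t/2=(t_1/2,t_3/2,\dots)$. Strict partitions: $DP$ is the set of sequences $\lambda=(\lambda_1>\cdots>\lambda_l>0)$ of integers, including the empty one $\emptyset$; $l(\lambda)=l$, $|\lambda|=\sum_i\lambda_i$, $2\lambda=(2\lambda_1,\dots,2\lambda_l)$. Schur Q-polynomials (normalized as in Macdonald's book): define $q_k(\mathbf t)$ by $\sum_{k\ge0}q_k(\mathbf t)z^k=\exp\big(2\sum_{k\ge0}t_{2k+1}z^{2k+1}\big)$. For non-negative integers $(r,s)\ne(0,0)$ put $M_{(r,s)}=q_rq_s+2\sum_{i=1}^s(-1)^iq_{r+i}q_{s-i}$, and $M_{(0,0)}=0$. For $\lambda\in DP$ of even length $2m$, $Q_\lambda(\mathbf t)=\mathrm{Pf}(M_{(\lambda_i,\lambda_j)})_{1\le i,j\le2m}$; for $\lambda\in DP$ of odd length, $Q_\lambda$ is the same Pfaffian for the sequence $(\lambda,0)$; $Q_\emptyset=1$. $Q_\lambda(\delta_{k,1})$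 is the value of $Q_\lambda$ at $t_k=\delta_{k,1}$ for all $k$; $Q_\lambda(\delta_{k,3}/3)$ is the value at $t_k=\delta_{k,3}/3$ for all $k$. Hypergeometric tau functions (Orlov): a formal series $\tau(\mathbf t)$ with coefficients in a field $K$ (here $K=\mathbb C(\hbar^{1/3})$) is a hypergeometric tau function of the BKP hierarchy if there are constants $\mathbf t^*=(t_1^*,t_3^*,\dots)$ in $K$ and a function $r:\mathbb Z_{>0}\to K$ such that $$\tau(\mathbf t)=\sum_{\lambda\in DP}2^{-l(\lambda)}\,r_\lambda\,Q_\lambda(\mathbf t/2)\,Q_\lambda(\mathbf t^*/2),\qquad r_\lambda=\prod_{i=1}^{l(\lambda)}\prod_{j=1}^{\lambda_i}r(j).$$ *)

(* Defs.v *)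
From HB Require Import structures.
From mathcomp Require Import all_boot all_order all_fingroup all_algebra.
From mathcomp Require Import fraction finmap complex.
From mathcomp Require Import boolp classical_sets cardinality fsbigop reals.
From mathcomp.multinomials Require Import monalg.

Set Implicit Arguments.
Unset Strict Implicit.
Unset Printing Implicit Defensive.

Import GRing.Theory Num.Theory.

Local Open Scope ring_scope.
Local Open Scope classical_set_scope.

(* The empty partition is [::]. *)
Definition DP : set (seq nat) :=
  [set la | sorted gtn la /\ 0%N \notin la].

Section Polynomials.
(* The inverses of factorials below are meaningful in characteristic 0. *)
Variable K : fieldType.

(* The variable of index k : nat is t_(2k+1). *)
Definition tmon := {cmonom nat}.
Definition tpoly := {malg K[tmon]}.
Definition tvar (k : nat) : tpoly := << ucm k >>.

Definition teval (v : nat -> K) (p : tpoly) : K :=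
  mmap idfun (fun m : tmon => \prod_(k <- finsupp m) v k ^+ m k) p.

(* The argument of the exponential has no constant term, so only its terms
   of degree at most k in z, and only the powers 0, ..., k in the exponential
   series, contribute to the coefficient of z^k. *)
Definition q_gen_arg (k : nat) : {poly tpoly} :=
  2%:R * \sum_(i < k.+1) tvar i *: 'X^(i.*2.+1).

Definition schur_q (k : nat) : tpoly :=
  \sum_(j < k.+1) (j`!%:R : K)^-1 *: (q_gen_arg k ^+ j)`_k.

Definition schur_M (r s : nat) : tpoly :=
  if (r == 0%N) && (s == 0%N) then 0 else
  schur_q r * schur_q s +
  2%:R * \sum_(1 <= i < s.+1) (-1) ^+ i * (schur_q (r + i) * schur_q (s - i)).

(* With indices counted from 0, ordS sends an even i to i + 1. *)
Definition pfaffian (m : nat) (A : 'M[tpoly]_(m.*2)) : tpoly :=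
  ((2 ^ m * m`!)%N%:R : K)^-1 *:
    \sum_(s : 'S_(m.*2))
      (-1) ^+ s * \prod_(i < m.*2 | ~~ odd i) A (s i) (s (ordS i)).

(* When the length of la is odd, the default value of nth supplies the
   trailing 0 that makes it even. *)
Definition schur_Q (la : seq nat) : tpoly :=
  @pfaffian (uphalf (size la))
    (\matrix_(i, j) schur_M (nth 0%N la i) (nth 0%N la j)).

(* Formal power series in t_1, t_3, ..., given by their coefficients. *)
Definition tseries := tmon -> K.

Definition tseries_of (p : tpoly) : tseries := fun m => p@_m.

(* s(c t): the coefficient of a monomial of degree d is multiplied by c^d. *)
Definition rescale (c : K) (s : tseries) : tseries :=
  fun m => c ^+ mdeg m * s m.

Definition DP_summable (F : seq nat -> tseries) : Prop :=
  forall m, finite_set [set la | DP la /\ F la m != 0].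

(* \sum_(la \in DP) is the sum over the finite support of F ^~ m in DP; that
   this support is finite is proved below for the two series in use. *)
Definition DP_sum (F : seq nat -> tseries) : tseries :=
  fun m => \sum_(la \in DP) F la m.

Definition r_prod (r : nat -> K) (la : seq nat) : K :=
  \prod_(l <- la) \prod_(1 <= j < l.+1) r j.

Definition hypergeometric_term (tstar r : nat -> K) (la : seq nat) : tseries :=
  fun m => 2%:R ^- size la * r_prod r la
    * rescale 2%:R^-1 (tseries_of (schur_Q la)) m
    * teval (fun k => tstar k / 2%:R) (schur_Q la).

(* tstar k is the constant t*_(2k+1); the value r 0 is not used. *)
Definition hypergeometric_BKP_tau (tau : tseries) : Prop :=
  exists tstar r : nat -> K,
    tau =1 DP_sum (hypergeometric_term tstar r).

Definition delta1 (k : nat) : K := (k.*2.+1 == 1)%N%:R.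
Definition delta3_3 (k : nat) : K := (k.*2.+1 == 3)%N%:R / 3%:R.

End Polynomials.

Section Homogeneity.
Variable K : fieldType.
Local Notation tpoly := (tpoly K).

Definition tweight (m : tmon) : nat := \sum_(k <- finsupp m) m k * k.*2.+1.

Definition homog (d : nat) (p : tpoly) : Prop :=
  forall m, p@_m != 0 -> tweight m = d.

Lemma tweightEw (m : tmon) (d : {fset nat}) : (finsupp m `<=` d)%fset ->
  tweight m = (\sum_(k <- d) m k * k.*2.+1)%N.
Proof.
move=> le; rewrite /tweight (big_fset_incl _ le) // => i _.
by rewrite -cmE_neq0 negbK => /eqP ->.
Qed.

Lemma tweightM (m1 m2 : tmon) : tweight (mmul m1 m2) = (tweight m1 + tweight m2)%N.
Proof.
rewrite {1}/tweight mdomD (tweightEw (fsubsetUl _ (finsupp m2))).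
rewrite (tweightEw (fsubsetUr (finsupp m1) _)) -big_split /=.
by apply/eq_bigr => i _; rewrite cmM mulnDl.
Qed.

Lemma homog0 d : homog d 0.
Proof. by move=> m; rewrite mcoeff0 eqxx. Qed.

Lemma homog1 : homog 0 1.
Proof.
move=> m; rewrite mcoeff1; case: (m =P mone) => [-> _|]; last by rewrite eqxx.
by rewrite /tweight mdom1 big_seq_fset0.
Qed.

Lemma homogD d p q : homog d p -> homog d q -> homog d (p + q).
Proof.
move=> hp hq m; rewrite mcoeffD; have [p0|/hp//] := eqVneq p@_m 0.
by rewrite p0 add0r => /hq.
Qed.

Lemma homog_sum d (I : Type) (r : seq I) (P : pred I) (F : I -> tpoly) :
  (forall i, P i -> homog d (F i)) -> homog d (\sum_(i <- r | P i) F i).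
Proof. by move=> h; elim/big_ind: _ => //; [exact: homog0|exact: homogD]. Qed.

Lemma homogZ d c p : homog d p -> homog d (c *: p).
Proof. by move=> hp m; rewrite mcoeffZ mulf_eq0 => /norP[_ /hp]. Qed.

Lemma homogM d e p q : homog d p -> homog e q -> homog (d + e) (p * q).
Proof.
move=> hp hq m; rewrite mcoeff_neq0 => /msuppM_le[k1 [k2 []]].
by rewrite -!mcoeff_neq0 => /hp <- /hq <- ->; exact: tweightM.
Qed.

Lemma homogMn d p n : homog d p -> homog d (p *+ n).
Proof. by move=> hp; rewrite -scaler_nat; exact: homogZ. Qed.

Lemma homog_sign d (n : nat) p : homog d p -> homog d ((-1) ^+ n * p).
Proof.
move=> hp; rewrite -signr_odd mulr_sign; case: (odd n) => //.
by rewrite -scaleN1r; exact: homogZ.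
Qed.

Lemma homog_prod (I : Type) (r : seq I) (P : pred I) (D : I -> nat) (F : I -> tpoly) :
  (forall i, P i -> homog (D i) (F i)) ->
  homog (\sum_(i <- r | P i) D i) (\prod_(i <- r | P i) F i).
Proof.
move=> h; elim/big_ind2 : _ => //; first exact: homog1.
by move=> ????; exact: homogM.
Qed.

Lemma homog_tvar k : homog k.*2.+1 (tvar K k).
Proof.
move=> m; rewrite mcoeffU1; case: (ucm k =P m) => [<- _|]; last by rewrite eqxx.
by rewrite /tweight mdomU big_seq_fset1 cmUU mul1n.
Qed.

Lemma homog_q_pow k j n : homog n (q_gen_arg K k ^+ j)`_n.
Proof.
elim: j n => [|j IHj] n.
  by rewrite expr0 coef1; case: eqP => [->|_]; [exact: homog1|exact: homog0].
rewrite exprS coefM; apply: homog_sum => i _.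
rewrite -[X in homog X](subnKC (ltn_ord i : i <= n)%N).
apply: homogM => //; rewrite /q_gen_arg mulr_natl coefMn; apply: homogMn.
rewrite coef_sum; apply: homog_sum => l _; rewrite coefZ coefXn.
case: eqP => [->|_]; last by rewrite mulr0; exact: homog0.
by rewrite mulr1; exact: homog_tvar.
Qed.

Lemma homog_schur_q k : homog k (schur_q K k).
Proof. by apply: homog_sum => j _; apply/homogZ/homog_q_pow. Qed.

Lemma homog_schur_M r s : homog (r + s) (schur_M K r s).
Proof.
rewrite /schur_M; case: ifP => _; first exact: homog0.
apply: homogD; first by apply: homogM; exact: homog_schur_q.
rewrite mulr_natl; apply: homogMn; rewrite big_nat_cond.
apply: homog_sum => i /andP[/andP[_ ilts] _]; apply: homog_sign.
rewrite -[X in homog X](_ : (r + i + (s - i) = _)%N).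
  by apply: homogM; exact: homog_schur_q.
by rewrite -addnA subnKC.
Qed.

(* Q_la is homogeneous of degree |la|, where t_k has degree k. *)
Lemma homog_schur_Q la : homog (sumn la) (schur_Q K la).
Proof.
apply: homogZ; apply: homog_sum => s _; apply: homog_sign.
set n := (uphalf (size la)).*2.
have -> : sumn la =
    (\sum_(i < n | ~~ odd i) (nth 0 la (s i) + nth 0 la (s (ordS i))))%N.
  have lan : (size la <= n)%N.
    rewrite /n uphalf_half doubleD -{1}(odd_double_half (size la)) leq_add2r.
    by case: odd.
  have -> : sumn la = (\sum_(i < n) nth 0 la i)%N.
    rewrite sumnE (big_nth 0%N) big_mkord (big_ord_widen _ (nth 0%N la) lan) big_mkcond /=.
    apply: eq_bigr => i _; case: ltnP => // ?; by rewrite nth_default.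
  rewrite (reindex_inj (@perm_inj _ s)) /= big_split /=.
  rewrite (bigID (fun i : 'I_n => ~~ odd i)) /=; congr addn.
  rewrite (reindex_inj (bij_inj (@ordS_bij n))) /=; apply: eq_bigl => i.
  rewrite negbK.
  case: i => i /= ltin; have [iE|neq] := eqVneq i.+1 n.
    by rewrite iE modnn -[RHS]/(odd i.+1) iE odd_double.
  by rewrite modn_small // ltn_neqAle neq.
by apply: homog_prod => i _; rewrite mxE; exact: homog_schur_M.
Qed.

Lemma DP_summable_schur_Q (F : seq nat -> tseries K) (c : seq nat -> tseries K) :
  (forall la m, F la m = c la m * tseries_of (schur_Q K la) m) -> DP_summable F.
Proof.
move=> FE m; pose w := tweight m.
have : finite_set [set` [fset [seq nat_of_ord i | i <- val s]
                        | s in {: w.-bseq 'I_w.+1}]%fset].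
  exact: finite_fset.
apply: sub_finite_set => la [[la_sorted la0]].
rewrite FE mulf_eq0 => /norP[_ /homog_schur_Q].
rewrite -/w => lw /=.
have ltla : forall x, x \in la -> (x < w.+1)%N.
  by move=> x xla; rewrite ltnS lw sumnE (big_rem x xla) leq_addr.
have sz : (size (pmap insub la : seq 'I_w.+1) <= w)%N.
  rewrite size_pmap_sub; apply: leq_trans (count_size _ _) _; rewrite lw.
  elim: la la0 {la_sorted lw ltla} => //= x s IHs; rewrite inE negb_or eq_sym.
  by move=> /andP[x0 /IHs h]; rewrite -addn1 addnC leq_add // lt0n.
apply/imfsetP; exists (Bseq sz) => //=.
elim: la ltla {la_sorted la0 lw sz} => //= x s IHs ltla.
rewrite (insubT (fun x => (x < w.+1)%N)) /= ?ltla ?mem_head // => h.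
by rewrite -IHs // => y ys; apply: ltla; rewrite inE ys orbT.
Qed.

Lemma hypergeometric_summable (tstar r : nat -> K) :
  DP_summable (hypergeometric_term tstar r).
Proof.
apply: (DP_summable_schur_Q (c := fun la m => 2%:R ^- size la * r_prod r la
  * teval (fun k => tstar k / 2%:R) (schur_Q K la) * 2%:R^-1 ^+ mdeg m)).
by move=> la m; rewrite /hypergeometric_term /rescale mulrAC mulrA.
Qed.

End Homogeneity.

Section MironovMorozov.
Variable R : realType.

(* The field C(hbar^(1/3)) of rational functions in the variable hbar^(1/3). *)
Definition hbarK : fieldType := {fraction {poly R[i]}}.

Definition hbar_cbrt : hbarK := tofrac ('X : {poly R[i]}).

(* (hbar / 16)^(1/3). Only partitions with |la| divisible by 3 contribute to
   tau_MM, so it does not depend on the choice of the cube root of 16. *)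
Definition hbar16_cbrt : hbarK :=
  hbar_cbrt / tofrac (3.-root (16%:R : R[i]))%:P.

Definition tau_MM_term (la : seq nat) : tseries hbarK :=
  fun m => hbar16_cbrt ^+ sumn la * 2%:R ^- size la
    * (teval (delta1 hbarK) (schur_Q hbarK la)
       * teval (delta3_3 hbarK) (schur_Q hbarK (map double la))
       / teval (delta1 hbarK) (schur_Q hbarK (map double la)))
    * tseries_of (schur_Q hbarK la) m.

Definition tau_MM : tseries hbarK := DP_sum tau_MM_term.

Lemma tau_MM_summable : DP_summable tau_MM_term.
Proof. exact: DP_summable_schur_Q. Qed.

End MironovMorozov.

(* Main.v *)
Require Import Defs.
From HB Require Import structures.
From mathcomp Require Import all_boot all_order all_fingroup all_algebra.
From mathcomp Require Import fraction finmap complex.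
From mathcomp Require Import boolp fsbigop reals.
From mathcomp.multinomials Require Import monalg.
From mathcomp Require Import ring zify.

(** Write M(r, s) for the Pfaffian entries at a given specialization. At
    t = delta_(k,1) one has q_k = 2^k / k! and
    M(r, s) = q_r q_s (r - s) / (r + s), so M(2r, 2s) = H(r) H(s) M(r, s) with
    H(k) = q_(2k) / q_k. At t = delta_(k,3) / 3 only the q_(3a) survive, and
    M(r, s) = f(r) f(s) g(r, s), where g vanishes unless 3 divides r + s and is
    (r - s) / (r + s) or +-6 / (r + s), according to the residues mod 3. Doubling
    swaps the residues 1 and 2, hence again M(2r, 2s) = F(r) F(s) M(r, s). Such
    factors come out of Pfaffians, so with t* = 2 delta_(k,3) / 3 and
    r(j) = G(j) / G(j - 1), G(k) = u^k F(k) / H(k), u = (hbar / 16)^(1/3), the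
    two series agree term by term.

    The division by Q_(2 lambda)(delta_(k,1)) requires this value to be nonzero,
    i.e. that Schur's Pfaffian Pf((x_i - x_j) / (x_i + x_j)) does not vanish.
    As a function of x_0 = X, with denominators cleared, it is a polynomial of
    degree < 2m which vanishes at X = x_1, ..., x_(2m-1). A further root x_0 would
    make it identically zero, but at X = -x_1 only the terms pairing 0 with 1
    survive, and they give a nonzero multiple of the Pfaffian of x_2, ... *)

Set Implicit Arguments.
Unset Strict Implicit.
Unset Printing Implicit Defensive.

Import GRing.Theory Num.Theory.

Local Open Scope ring_scope.

(** * Lifted permutations and pairs of neighbouring indices *)

Lemma lift_perm_inj n (i j : 'I_n.+1) : injective (lift_perm i j).
Proof.
move=> s t est; apply/permP => k; apply: (@lift_inj _ j).
by rewrite -!(lift_perm_lift i) est.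
Qed.

Lemma lift_perm_surj n (i j : 'I_n.+1) (s : 'S_n.+1) :
  s i = j -> exists t, s = lift_perm i j t.
Proof.
(* The default k is never reached: s (lift i k) = j would force lift i k = i. *)
move=> sij; pose f k := odflt k (unlift j (s (lift i k))).
have fE k : lift j (f k) = s (lift i k).
  rewrite /f; case: unliftP => [//|e].
  by have := neq_lift i k; rewrite -(inj_eq (@perm_inj _ s)) sij e eqxx.
have f_inj : injective f.
  by move=> k l e; apply/(@lift_inj _ i)/(@perm_inj _ s); rewrite -!fE e.
exists (perm f_inj); apply/permP => k.
case: (unliftP i k) => [l|] ->; last by rewrite lift_perm_id.
by rewrite lift_perm_lift permE fE.
Qed.

Lemma even_ltn_double i k : ~~ odd i -> (i < k.*2)%N -> (i.+1 < k.*2)%N.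
Proof.
move=> i_even ik; rewrite ltn_neqAle ik andbT; apply: contraTneq i_even => e.
by move/(congr1 odd): e; rewrite /= odd_double => ->.
Qed.

(** For even n, [ordS] maps the even indices bijectively onto the odd ones. *)
Lemma big_ord_pairs (T : Type) (idx : T) (op : Monoid.com_law idx) n
    (c : 'I_n -> T) : odd n = false ->
  \big[op/idx]_(i < n | ~~ odd i) op (c i) (c (ordS i)) = \big[op/idx]_i c i.
Proof.
move=> n_even; rewrite big_split /= [RHS](bigID (fun i : 'I_n => ~~ odd i)) /=.
congr (op _ _); rewrite [RHS](reindex_inj (bij_inj (@ordS_bij n))) /=.
apply: eq_bigl => i; have := ltn_ord i; rewrite leq_eqVlt => /predU1P[e|lt].
  by rewrite e modnn negbK; move/(congr1 odd): e; rewrite /= n_even.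
by rewrite modn_small //= negbK.
Qed.

Lemma ordS_neq n (i : 'I_n) : odd n = false -> i != ordS i.
Proof.
move=> n_even; rewrite -val_eqE /=.
have := ltn_ord i; rewrite leq_eqVlt => /predU1P[e|lt].
  by rewrite e modnn; apply: contraFneq n_even => i0; rewrite -e i0.
by rewrite modn_small // neq_ltn leqnn.
Qed.

(** * Pfaffians as signed sums over permutations *)

Section PfaffianSum.
Variable R : comNzRingType.

Definition pf_prod n (a : 'I_n -> 'I_n -> R) (s : 'S_n) : R :=
  \prod_(i < n | ~~ odd i) a (s i) (s (ordS i)).

(* For n = 2m and a skew, this is 2^m m! times the Pfaffian of a. *)
Definition pf_sum n (a : 'I_n -> 'I_n -> R) : R :=
  \sum_(s : 'S_n) (-1) ^+ s * pf_prod a s.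

Lemma eq_pf_sum n (a b : 'I_n -> 'I_n -> R) : odd n = false ->
  (forall i j, i != j -> a i j = b i j) -> pf_sum a = pf_sum b.
Proof.
move=> n_even eab; apply: eq_bigr => s _; congr (_ * _); apply: eq_bigr => i _.
by apply: eab; rewrite (inj_eq (@perm_inj _ s)) ordS_neq.
Qed.

(** Each index lies in exactly one pair of each product, so every term carries the same product of
    all c i. *)
Lemma pf_sum_scale n (c : 'I_n -> R) (a : 'I_n -> 'I_n -> R) : odd n = false ->
  pf_sum (fun i j => c i * c j * a i j) = (\prod_i c i) * pf_sum a.
Proof.
move=> n_even; rewrite /pf_sum mulr_sumr; apply: eq_bigr => s _.
rewrite mulrCA; congr (_ * _); rewrite /pf_prod big_split /=; congr (_ * _).
rewrite [RHS](reindex_inj (@perm_inj _ s)) /=.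
exact: (big_ord_pairs _ (fun i => c (s i))).
Qed.

Lemma pf_sum_perm n (t : 'S_n) (a : 'I_n -> 'I_n -> R) :
  pf_sum (fun i j => a (t i) (t j)) = (-1) ^+ t * pf_sum a.
Proof.
rewrite /pf_sum [in RHS](reindex_inj (mulIg t)) /= mulr_sumr.
apply: eq_bigr => s _; rewrite odd_permM signr_addb mulrA mulrC -!mulrA.
rewrite -[X in _ = X]mulrCA (mulrCA _ _ (pf_prod _ _)) signrMK mulrC; congr (_ * _).
by apply: eq_bigr => i _; rewrite !permM.
Qed.

(* Each of the 2(m + 1) positions p of 0 contributes the same amount: the
   permutations placing 1 next to it are the lifts of those of 2m indices. *)
Lemma pf_sum_minor m (a : 'I_m.*2.+2 -> 'I_m.*2.+2 -> R) :
  (forall i j, a j i = - a i j) ->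
  (forall k, k != lift ord0 ord0 -> a ord0 k = 0) ->
  pf_sum a = m.+1.*2%:R * (a ord0 (lift ord0 ord0) *
    pf_sum (fun i j => a (lift ord0 (lift ord0 i)) (lift ord0 (lift ord0 j)))).
Proof.
move=> askew a0; set D := _ * pf_sum _.
rewrite /pf_sum (partition_big (fun s : 'S_m.*2.+2 => (s^-1)%g ord0) predT) //=.
suff TE p : \sum_(s : 'S_m.*2.+2 | (s^-1)%g ord0 == p)
    (-1) ^+ s * pf_prod a s = D.
  by rewrite (eq_bigr (fun=> D)) // sumr_const card_ord mulr_natl.
(* Position p lies in the pair 2k, 2k + 1, on the side [podd]; p' is its partner, numbered after the
   removal of p. *)
have [k [podd [p' [p'E pE]]]] : exists k, exists b : bool, exists p' : 'I_m.*2.+1,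
    nat_of_ord p' = k.*2 /\ nat_of_ord p = (k.*2 + b)%N.
  exists p./2, (odd p); have pk : (p./2.*2 < m.*2.+1)%N by case: p => /= p; lia.
  by exists (Ordinal pk); split => //=; rewrite addnC odd_double_half.
pose e (i : 'I_m.*2) := lift p (lift p' i).
pose E := fun t : 'S_m.*2 => lift_perm p ord0 (lift_perm p' ord0 t).
(* Since e skips one whole pair, it preserves parity and maps pairs to pairs. *)
have eE i : nat_of_ord (e i) = (if (i < k.*2)%N then nat_of_ord i else i.+2).
  rewrite /= /bump p'E pE; case: ltnP => /= ik; rewrite ?add0n ?add1n.
    by rewrite leqNgt ltn_addr.
  by case: podd {pE}; lia.
have Ee t i : E t (e i) = lift ord0 (lift ord0 (t i)).
  by rewrite /E /e !lift_perm_lift.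
have Ep t : E t p = ord0 by rewrite /E lift_perm_id.
have Ep' t : E t (lift p p') = lift ord0 ord0.
  by rewrite /E lift_perm_lift lift_perm_id.
have E_inj : injective E by move=> s t /lift_perm_inj/lift_perm_inj.
(* Outside the image of E the partner of 0 is not 1, so a factor of the product vanishes. *)
rewrite (bigID (mem (E @: setT))) /= [X in _ + X]big1 ?addr0; last first.
  move=> s /andP[/eqP sp]; have {}sp : s p = ord0 by rewrite -sp permKV.
  have [t' ->] := lift_perm_surj sp; have [tp'|tp'] := eqVneq (t' p') ord0.
    have [t ->] := lift_perm_surj tp'; move/negP; case; exact: imset_f.
  move=> _; set s' := lift_perm _ _ _.
  have s'p : s' p = ord0 by rewrite lift_perm_id.
  have s'p' : s' (lift p p') != lift ord0 ord0.
    by rewrite /s' lift_perm_lift (inj_eq lift_inj).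
  suff -> : pf_prod a s' = 0 by rewrite mulr0.
  case: podd pE => pE.
    have lE : ordS (lift p p') = p.
      by apply: val_inj; rewrite /= /bump p'E pE modn_small; have := ltn_ord p; lia.
    rewrite /pf_prod (bigD1 (lift p p')) /=; last by rewrite /bump p'E pE; lia.
    by rewrite lE s'p askew a0 // oppr0 mul0r.
  have lE : ordS p = lift p p'.
    by apply: val_inj; rewrite /= /bump p'E pE modn_small; have := ltn_ord p'; lia.
  rewrite /pf_prod (bigD1 p) /=; last by rewrite pE; lia.
  by rewrite lE s'p a0 // mul0r.
rewrite (eq_bigl (mem (E @: setT))); last first.
  move=> s /=; apply/andb_idl => /imsetP[t _ ->].
  by rewrite -(Ep t) permK.
rewrite big_imset /=; last by move=> s t _ _; exact: E_inj.
rewrite (eq_bigl predT) => [|t]; last by rewrite inE.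
rewrite /D /pf_sum mulr_sumr; apply: eq_bigr => t _.
(* This sign cancels the one that skewness produces when 0 is the second member of its pair. *)
have -> : (-1) ^+ E t = (-1) ^+ podd * (-1) ^+ t :> R.
  rewrite -signr_addb; congr (_ ^+ nat_of_bool _).
  by rewrite !odd_lift_perm p'E pE oddD odd_double; case: podd {pE}; case: (odd_perm t).
suff -> : pf_prod a (E t) = (-1) ^+ podd * a ord0 (lift ord0 ord0) *
   pf_prod (fun i j => a (lift ord0 (lift ord0 i)) (lift ord0 (lift ord0 j))) t.
  by rewrite -!mulrA (mulrCA _ ((-1) ^+ podd)) signrMK mulrCA.
rewrite /pf_prod big_mkcond (bigD1_ord p) //= (bigD1_ord p') //= mulrA.
congr (_ * _).
  case: podd pE => pE.
    have lE : ordS (lift p p') = p.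
      by apply: val_inj; rewrite /= /bump p'E pE modn_small; have := ltn_ord p; lia.
    rewrite ifF ?ifT; [|by rewrite /bump p'E pE; lia|by rewrite pE; lia].
    by rewrite lE Ep Ep' askew mul1r mulN1r.
  have lE : ordS p = lift p p'.
    by apply: val_inj; rewrite /= /bump p'E pE modn_small; have := ltn_ord p'; lia.
  rewrite ifT ?ifF; [|by rewrite /bump p'E pE; lia|by rewrite pE; lia].
  by rewrite lE Ep Ep' mul1r mulr1.
rewrite [RHS]big_mkcond /=; apply: eq_bigr => i _.
rewrite -[lift p (lift p' i)]/(e i) -[bump p (bump p' i)]/(nat_of_ord (e i)).
have -> : odd (e i) = odd i by rewrite eE; case: ifP => _ /=; rewrite ?negbK.
case: ifP => // i_even.
have -> : ordS (e i) = e (ordS i); last by rewrite !Ee.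
have lts := even_ltn_double i_even (ltn_ord i).
apply: val_inj; rewrite [RHS]eE /= -[bump p _]/(nat_of_ord (e i)) eE.
rewrite (modn_small lts); case: (ltnP i k.*2) => ik.
  by rewrite (even_ltn_double i_even ik) modn_small // ltnW // ltnW.
by rewrite ifF ?modn_small // ltnNge ltnW.
Qed.

End PfaffianSum.

Lemma rmorph_pf_sum (R S : comNzRingType) (f : {rmorphism R -> S}) n
    (a : 'I_n -> 'I_n -> R) :
  f (pf_sum a) = pf_sum (fun i j => f (a i j)).
Proof.
rewrite rmorph_sum; apply: eq_bigr => s _.
by rewrite rmorphM rmorph_sign rmorph_prod.
Qed.

(** Every index is used once in each product, so the weights d add up to the same degree bound for
    all terms. *)
Lemma size_pf_sum (R : comNzRingType) n (d : 'I_n -> nat)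
    (a : 'I_n -> 'I_n -> {poly R}) : odd n = false ->
  (forall i j, i != j -> size (a i j) <= (d i + d j).+1)%N ->
  (size (pf_sum a) <= (\sum_i d i).+1)%N.
Proof.
move=> n_even ad; apply: (leq_trans (size_sum _ _ _)); apply/bigmax_leqP => s _.
have -> : size ((-1) ^+ s * pf_prod a s) = size (pf_prod a s).
  by rewrite mulr_sign; case: ifP; rewrite ?size_polyN.
have -> : (\sum_i d i = \sum_(i < n | ~~ odd i) (d (s i) + d (s (ordS i))))%N.
  rewrite (reindex_inj (@perm_inj _ s)) /=.
  by rewrite -(big_ord_pairs addn (fun i => d (s i))).
rewrite /pf_prod.
elim/big_ind2 : _ => [|p dp q dq pd qd|i _]; first by rewrite size_poly1.
  apply: leq_trans (size_polyMleq _ _) _; lia.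
by apply: ad; rewrite (inj_eq (@perm_inj _ s)) ordS_neq.
Qed.

(** * Nonvanishing of Schur's Pfaffian *)

Section SchurPfaffian.
Variable K : fieldType.
Hypothesis char0 : forall n, n.+1%:R != 0 :> K.

Definition schur_entry (x y : K) : K := (x - y) / (x + y).

Lemma schur_entryC x y : schur_entry y x = - schur_entry x y.
Proof. by rewrite /schur_entry -mulNr opprB (addrC x y). Qed.

(** Exchanging the two equal variables fixes all entries but changes the sign of the sum. *)
Lemma pf_sum_schur_eq0 n (x : 'I_n -> K) i j : i != j -> x i = x j ->
  pf_sum (fun i j => schur_entry (x i) (x j)) = 0.
Proof.
move=> ij xij; set P := pf_sum _.
have PN : P = - P.
  have -> : - P = (-1) ^+ tperm i j * P by rewrite odd_tperm ij mulN1r.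
  rewrite -pf_sum_perm.
  have xt k : x (tperm i j k) = x k by case: tpermP => // ->; rewrite xij.
  by apply: eq_bigr => s _; congr (_ * _); apply: eq_bigr => k _; rewrite !xt.
have /eqP := PN; rewrite -addr_eq0 -mulr2n -mulr_natr mulf_eq0.
by rewrite (negPf (char0 1)) orbF => /eqP.
Qed.

Section FirstVariable.
Variables (n : nat) (y : 'I_n -> K).

Definition cons_var (z : K) (i : 'I_n.+1) : K := oapp y z (unlift ord0 i).

(* The product of all z + y_k times the entry (z - y_j) / (z + y_j), as a
   polynomial in z. *)
Definition clear_denom (j : 'I_n) : {poly K} :=
  ('X - (y j)%:P) * \prod_(k | k != j) ('X + (y k)%:P).

(** Schur's matrix in the variables z, y_0, y_1, ..., with the denominators of row and column 0
    cleared; z is the polynomial variable. *)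
Definition cleared_entry (i j : 'I_n.+1) : {poly K} :=
  match unlift ord0 i, unlift ord0 j with
  | None, None => 0
  | None, Some j => clear_denom j
  | Some i, None => - clear_denom i
  | Some i, Some j => (schur_entry (y i) (y j))%:P
  end.

Lemma size_clear_denom j : (size (clear_denom j) <= n.+1)%N.
Proof.
apply: leq_trans (size_polyMleq _ _) _; rewrite size_XsubC /=.
have -> : \prod_(k | k != j) ('X + (y k)%:P) =
    \prod_(k <- [seq - y k | k in predC1 j]) ('X - k%:P).
  rewrite big_image; apply: eq_big => [k|k _]; last by rewrite polyCN opprK.
  by rewrite inE.
rewrite size_prod_XsubC size_map -cardE cardC1 card_ord.
by case: n j => [[]|].
Qed.

(* The hypothesis allows z + y_k = 0 when both vanish: the entry is then 0, which
   is also the value of 0 / 0. *)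
Lemma horner_cleared_entry z i j : (forall k, z + y k = 0 -> z = y k) ->
  let c i := oapp (fun=> 1) (\prod_k (z + y k)) (unlift ord0 i) in
  (cleared_entry i j).[z] = c i * c j * schur_entry (cons_var z i) (cons_var z j).
Proof.
move=> zy c; have rE k :
    (clear_denom k).[z] = (\prod_k (z + y k)) * schur_entry z (y k).
  rewrite /clear_denom hornerM hornerXsubC horner_prod [in RHS](bigD1 k) //=.
  under eq_bigr do rewrite hornerD hornerX hornerC.
  rewrite /schur_entry mulrC; have [zk|zk] := eqVneq (z + y k) 0.
    by rewrite (zy k zk) subrr !mul0r !mulr0.
  by set P := \prod_(_ < _ | _) _; field.
rewrite /c /cons_var /cleared_entry.
case: (unliftP ord0 i) => [k|] _ /=; case: (unliftP ord0 j) => [l|] _ /=.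
- by rewrite !mul1r hornerC.
- by rewrite hornerN rE mul1r (schur_entryC z) mulrN.
- by rewrite rE mulr1.
- by rewrite horner0 /schur_entry subrr mul0r mulr0.
Qed.

Lemma horner_cleared_pf z : odd n -> (forall k, z + y k = 0 -> z = y k) ->
  (pf_sum cleared_entry).[z] = \prod_k (z + y k) *
    pf_sum (fun i j => schur_entry (cons_var z i) (cons_var z j)).
Proof.
move=> n_odd zy; rewrite -horner_evalE rmorph_pf_sum /horner_eval.
rewrite (@eq_pf_sum _ _ _ _ _ (fun i j _ => horner_cleared_entry i j zy)) /= ?n_odd //.
rewrite pf_sum_scale /= ?n_odd // big_ord_recl unlift_none /=.
by rewrite [X in _ * X * _]big1 ?mulr1 // => k _; rewrite liftK.
Qed.

End FirstVariable.

Lemma cons_varE n (x : 'I_n.+1 -> K) i : cons_var (x \o lift ord0) (x ord0) i = x i.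
Proof. by rewrite /cons_var; case: unliftP => [j|] ->. Qed.

Lemma pf_sum_schur_neq0 m (x : 'I_m.*2 -> K) : injective x ->
    (forall i j, i != j -> x i + x j != 0) ->
  pf_sum (fun i j => schur_entry (x i) (x j)) != 0.
Proof.
elim: m x => [|m IHm] x x_inj x_neq0.
  rewrite /pf_sum (eq_bigr (fun=> 1)) => [|s _].
    by rewrite sumr_const card_Sn oner_neq0.
  rewrite /pf_prod big_ord0 mulr1 (_ : s = 1%g) ?odd_perm1 //.
  by apply/permP => -[].
rewrite -[m.+1.*2]/m.*2.+2 in x x_inj x_neq0 *.
(* At most one variable is 0, and a transposition moves it from index 1 to index 0. The value at z =
   - x_1 below has a factor 2 x_1. *)
wlog x1 : x x_inj x_neq0 / x (lift ord0 ord0) != 0 => [hwlog|].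
  have [x1|/hwlog] := eqVneq (x (lift ord0 ord0)) 0; last exact.
  pose t : 'S_m.*2.+2 := tperm ord0 (lift ord0 ord0).
  have := hwlog (x \o t); rewrite (pf_sum_perm t (fun i j => schur_entry (x i) (x j))).
  rewrite mulf_eq0 signr_eq0; apply=> [|i j ij|] /=.
  - exact: inj_comp x_inj (@perm_inj _ t).
  - by rewrite x_neq0 // (inj_eq (@perm_inj _ t)).
  rewrite tpermR -x1; apply/eqP => /x_inj/(congr1 val); by [].
pose y := x \o lift ord0.
have m_odd : odd m.*2.+1 by rewrite /= odd_double.
have m_even : odd m.*2.+2 = false by rewrite /= odd_double.
have y_neq0 i j : i != j -> y i + y j != 0.
  by move=> ij; rewrite x_neq0 // (inj_eq lift_inj).
apply/eqP => Px0.
(* All 2m + 2 values x_i are roots: x_0 by assumption, the others because two variables then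
   coincide. *)
have f0 : pf_sum (cleared_entry y) = 0.
  apply: (@roots_geq_poly_eq0 _ _ (map x (enum 'I_m.*2.+2))).
  - apply/allP => _ /mapP[i _ ->]; apply/rootP.
    have yi k : x i + y k = 0 -> x i = y k.
      by have [->//|/x_neq0/eqP] := eqVneq i (lift ord0 k).
    rewrite (horner_cleared_pf m_odd yi).
    case: (unliftP ord0 i) => [j|] ->; last first.
      have -> : pf_sum (fun i j => schur_entry (cons_var y (x ord0) i)
          (cons_var y (x ord0) j)) = 0; last by rewrite mulr0.
      by rewrite -[RHS]Px0; apply: eq_pf_sum => // a b _; rewrite !cons_varE.
    rewrite (@pf_sum_schur_eq0 _ _ ord0 (lift ord0 j)) ?mulr0 ?neq_lift //.
    by rewrite /cons_var unlift_none liftK.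
  - by rewrite map_inj_uniq ?enum_uniq.
  rewrite size_map size_enum_ord.
  (* Only row and column 0 depend on z, and each term has a single factor from them. *)
  pose d (i : 'I_m.*2.+2) := if i == ord0 then m.*2.+1 else 0%N.
  apply: leq_trans (size_pf_sum (d := d) m_even _) _.
    move=> i j; rewrite /cleared_entry /d.
    case: (unliftP ord0 i) => [k|] ->; case: (unliftP ord0 j) => [l|] -> _ /=.
    + by rewrite size_polyC_leq1.
    + by rewrite size_polyN add0n size_clear_denom.
    + by rewrite addn0 size_clear_denom.
    + by rewrite size_poly0.
  by rewrite big_ord_recl /= big1 ?addn0.
have : (pf_sum (cleared_entry y)).[- y ord0] = 0 by rewrite f0 horner0.
apply/eqP; rewrite -horner_evalE rmorph_pf_sum pf_sum_minor /=; first 1 last.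
- move=> i j; rewrite /horner_eval /cleared_entry -hornerN.
  case: (unliftP ord0 i) => [k|] _; case: (unliftP ord0 j) => [l|] _ //=.
  + by rewrite schur_entryC polyCN.
  + by rewrite opprK.
  + by rewrite oppr0.
- move=> k; rewrite /horner_eval /cleared_entry unlift_none.
  case: (unliftP ord0 k) => [l|] -> kl; last by rewrite horner0.
  rewrite /clear_denom hornerM horner_prod (bigD1 ord0) /=.
    by rewrite !hornerE addNr /= mulr0 mul0r.
  by apply: contraNneq kl => ->.
rewrite (@eq_pf_sum _ _ _ (fun i j => schur_entry (y (lift ord0 i)) (y (lift ord0 j)))).
- rewrite /horner_eval /cleared_entry unlift_none liftK.
  rewrite doubleS !mulf_neq0 ?char0 ?IHm //; last first.
  + by move=> i j ij; rewrite y_neq0 // (inj_eq lift_inj).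
  + by move=> i j /x_inj/lift_inj/lift_inj.
  (* The surviving entry is - 2 y_0 times the product of the y_k - y_0 for k != 0. *)
  rewrite /clear_denom hornerM hornerXsubC horner_prod mulf_neq0 //.
    rewrite -opprD oppr_eq0 -mulr2n -mulr_natr mulf_neq0 //; exact: (char0 1).
  apply/prodf_neq0 => k k0; rewrite hornerD hornerX hornerC addrC subr_eq0.
  by rewrite (inj_eq x_inj) (inj_eq lift_inj).
- exact: odd_double.
by move=> i j _; rewrite /horner_eval /cleared_entry !liftK hornerC.
Qed.

End SchurPfaffian.

(** * Alternating sums behind the entries M(r, s) *)

Definition alt_sum (R : comNzRingType) (q : nat -> R) (r s : nat) : R :=
  \sum_(i < s.+1) (-1) ^+ i * (q (r + i)%N * q (s - i)%N).

Lemma alt_sum0 (R : comNzRingType) (q : nat -> R) r : alt_sum q r 0 = q r * q 0%N.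
Proof. by rewrite /alt_sum big_ord_recl big_ord0 addr0 mul1r addn0. Qed.

(** The sum includes i = 0, so that peeling this term off leaves a sum of the same shape with the
    same total index r + s. *)
Lemma alt_sumS (R : comNzRingType) (q : nat -> R) r s :
  alt_sum q r s.+1 = q r * q s.+1 - alt_sum q r.+1 s.
Proof.
rewrite /alt_sum big_ord_recl /= mul1r addn0 subn0 -sumrN; congr (_ + _).
by apply: eq_bigr => i _; rewrite /bump /= add1n exprS addnS addSn subSS mulN1r mulNr.
Qed.

Lemma rmorph_alt_sum (R S : comNzRingType) (f : {rmorphism R -> S})
    (Q : nat -> R) r s (q := fun k => f (Q k)) :
  f (Q r * Q s +
    2%:R * \sum_(1 <= i < s.+1) (-1) ^+ i * (Q (r + i)%N * Q (s - i)%N)) =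
  2%:R * alt_sum q r s - q r * q s.
Proof.
rewrite rmorphD !rmorphM rmorph_nat rmorph_sum /= big_add1 /= big_mkord.
rewrite /alt_sum big_ord_recl /= mul1r addn0 subn0.
rewrite (eq_bigr (fun i : 'I_s =>
    (-1) ^+ bump 0 i * (q (r + bump 0 i)%N * q (s - bump 0 i)%N))) => [|i _].
  by rewrite -/(q r) -/(q s); set S0 := \sum_(_ < _) _; ring.
by rewrite 2!rmorphM rmorph_sign.
Qed.

(** * Evaluation of Schur Q-polynomials *)

Section Evaluation.
Variable K : fieldType.

(** The monomial part of [teval], isolated so that its multiplicativity makes [teval] a linear ring
    morphism. *)
Definition mon_eval (v : nat -> K) (m : tmon) : K :=
  \prod_(k <- finsupp m) v k ^+ m k.

Lemma mon_evalEw v (m : tmon) (d : {fset nat}) : (finsupp m `<=` d)%fset ->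
  mon_eval v m = \prod_(k <- d) v k ^+ m k.
Proof.
move=> le; rewrite /mon_eval (big_fset_incl _ le) // => i _.
by rewrite -cmE_neq0 negbK => /eqP ->.
Qed.

Lemma mon_eval_mmorphism v : mmorphism (mon_eval v).
Proof.
split=> [m1 m2|]; last by rewrite /mon_eval mdom1 big_seq_fset0.
rewrite {1}/mon_eval mdomD (mon_evalEw v (fsubsetUl _ (finsupp m2))).
rewrite (mon_evalEw v (fsubsetUr (finsupp m1) _)) -big_split /=.
by apply: eq_bigr => i _; rewrite cmM exprD.
Qed.

HB.instance Definition _ v :=
  monalg.isMultiplicative.Build tmon K (mon_eval v) (mon_eval_mmorphism v).

HB.instance Definition _ v :=
  GRing.LRMorphism.copy (teval v) (mmap idfun (mon_eval v)).

Lemma teval_tvar v k : teval v (tvar K k) = v k.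
Proof. by rewrite /teval mmapU mul1r mdomU big_seq_fset1 cmUU expr1. Qed.

Lemma tevalZ v c (p : tpoly K) : teval v (c *: p) = c * teval v p.
Proof. exact: linearZ. Qed.

Lemma map_q_gen_arg v a k : (forall i, i != a -> v i = 0) ->
  map_poly (teval v) (q_gen_arg K k) =
    (if (a <= k)%N then 2%:R * v a else 0) *: 'X^(a.*2.+1).
Proof.
move=> va; rewrite /q_gen_arg rmorphM rmorph_nat rmorph_sum /=.
under eq_bigr do rewrite map_polyZ map_polyXn /= teval_tvar.
have [ak|ka] := leqP a k.
  rewrite (bigD1 (Ordinal (ak : a < k.+1)%N)) //= big1 ?addr0 => [|i ia].
    by rewrite -scalerA scaler_nat mulr_natl.
  by rewrite va ?scale0r.
rewrite scale0r big1 ?mulr0 // => i _.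
by rewrite va ?scale0r // neq_ltn (leq_ltn_trans _ ka) // -ltnS.
Qed.

(** When only t_N is nonzero, the generating series is exp(2 t_N z^N). *)
Lemma teval_schur_q v a k (N := a.*2.+1) : (forall i, i != a -> v i = 0) ->
  teval v (schur_q K k) =
    if (N %| k)%N then (2%:R * v a) ^+ (k %/ N) / ((k %/ N)`!)%:R else 0.
Proof.
move=> va; rewrite /schur_q rmorph_sum /=.
have jE (j : 'I_k.+1) : teval v ((j`!%:R : K)^-1 *: (q_gen_arg K k ^+ j)`_k) =
    if k == (N * j)%N then (2%:R * v a) ^+ j / j`!%:R else 0.
  rewrite tevalZ -coef_map rmorphXn /= (map_q_gen_arg _ va) exprZn -exprM.
  rewrite coefZ coefXn -/N; case: eqP => [kE|_]; last by rewrite !mulr0.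
  case: leqP => ak; first by rewrite mulr1 mulrC.
  (* Here the truncated argument misses t_N; then k < a < N, and k = N j leaves only j = 0. *)
  have j0 : nat_of_ord j = 0%N.
    move: kE ak; case: (nat_of_ord j) => // l ->.
    by rewrite /N mulnS ltnNge => /negP[]; lia.
  by rewrite j0 !expr0 !mulr1 mul1r.
under eq_bigr do rewrite jE.
case: dvdnP => [[l kE]|kN]; last first.
  by rewrite big1 // => j _; case: eqP => // kE; case: kN; exists j; rewrite mulnC.
have lk : (l < k.+1)%N by rewrite kE ltnS leq_pmulr.
have -> : (k %/ N = l)%N by rewrite kE mulnK.
rewrite mulnC in kE; rewrite (bigD1 (Ordinal lk)) //= big1 => [|j jl].
  by rewrite addr0 -kE eqxx.
case: eqP => // kE'; case/eqP: jl; apply: val_inj => /=; apply/eqP.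
by rewrite -(@eqn_pmul2l N) // -kE' -kE.
Qed.

Lemma teval_schur_M v q r s : (fun k => teval v (schur_q K k)) =1 q ->
  teval v (schur_M K r s) =
    if (r == 0%N) && (s == 0%N) then 0 else 2%:R * alt_sum q r s - q r * q s.
Proof.
move=> /funext <-; rewrite /schur_M; case: ifP => _; first by rewrite rmorph0.
exact: (rmorph_alt_sum (teval v)).
Qed.

Definition seq_pf (M : nat -> nat -> K) (la : seq nat) : K :=
  let m := uphalf (size la) in ((2 ^ m * m`!)%N%:R)^-1 *
    pf_sum (fun i j : 'I_m.*2 => M (nth 0%N la i) (nth 0%N la j)).

Lemma teval_schur_Q v la :
  teval v (schur_Q K la) = seq_pf (fun r s => teval v (schur_M K r s)) la.
Proof.
rewrite /schur_Q /pfaffian tevalZ; congr (_ * _).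
apply: etrans (rmorph_pf_sum (teval v) _); apply: (congr1 (teval v)).
by apply: eq_bigr => s _; congr (_ * _); apply: eq_bigr => i _; rewrite mxE.
Qed.

Lemma size_le_uphalf (la : seq nat) : (size la <= (uphalf (size la)).*2)%N.
Proof.
by rewrite uphalf_half doubleD -{1}(odd_double_half (size la)) leq_add2r; case: odd.
Qed.

(** The condition F 0 = 1 makes the trailing 0 of a sequence of odd length contribute no factor. *)
Lemma seq_pf_scale (M M' : nat -> nat -> K) (F : nat -> K) la : F 0%N = 1 ->
  (forall r s, M' r s = F r * F s * M r s) ->
  seq_pf M' la = (\prod_(l <- la) F l) * seq_pf M la.
Proof.
move=> F0 FM; rewrite /seq_pf [RHS]mulrCA; congr (_ * _).
have -> : \prod_(l <- la) F l = \prod_(i < (uphalf (size la)).*2) F (nth 0%N la i).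
  rewrite (big_nth 0%N) big_mkord.
  rewrite (big_ord_widen _ (fun i => F (nth 0%N la i)) (size_le_uphalf la)).
  rewrite big_mkcond /=; apply: eq_bigr => i _.
  by case: ltnP => // ?; rewrite nth_default.
by rewrite -pf_sum_scale ?odd_double //; apply: eq_pf_sum; rewrite ?odd_double.
Qed.

Lemma seq_pf_map_double M la :
  seq_pf M (map double la) = seq_pf (fun r s => M r.*2 s.*2) la.
Proof.
have nthE k : nth 0%N (map double la) k = (nth 0%N la k).*2.
  case: (ltnP k (size la)) => kla; first by rewrite (nth_map 0%N).
  by rewrite !nth_default ?size_map.
rewrite /seq_pf size_map; congr (_ * _).
by apply: eq_pf_sum => [|i j _]; rewrite ?odd_double // !nthE.
Qed.

Section Characteristic0.
Hypothesis char0 : forall n, n.+1%:R != 0 :> K.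

Lemma natr_eq0_char0 n : (n%:R == 0 :> K) = (n == 0%N).
Proof. by case: n => [|n]; rewrite ?eqxx // (negPf (char0 n)). Qed.

Lemma natr_inj_char0 : injective (fun n => n%:R : K).
Proof.
move=> m n /eqP; wlog nm : m n / (n <= m)%N => [hwlog|] mn.
  by have [/hwlog|/ltnW/hwlog h] := leqP n m; [exact|apply/esym/h; rewrite eq_sym].
move: mn; rewrite -subr_eq0 -natrB // natr_eq0_char0 subn_eq0 => mn.
by apply/eqP; rewrite eqn_leq mn.
Qed.

(** * The specialization at delta_(k,1), with generating series exp(p z) for p = 2 *)

Definition expq (p : K) (k : nat) : K := p ^+ k / k`!%:R.

Lemma expq0 p : expq p 0 = 1.
Proof. by rewrite /expq expr0 divr1. Qed.

Lemma fact_neq0 k : k`!%:R != 0 :> K.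
Proof. by rewrite natr_eq0_char0 -lt0n fact_gt0. Qed.

Lemma expqS p k : k.+1%:R * expq p k.+1 = p * expq p k.
Proof.
by rewrite /expq factS natrM exprS; field; rewrite fact_neq0 nat1r char0.
Qed.

Lemma expq_neq0 p k : p != 0 -> expq p k != 0.
Proof. by move=> p0; rewrite mulf_neq0 ?expf_neq0 // invr_eq0 fact_neq0. Qed.

(** Induction on s for all r: [alt_sumS] passes from (r, s + 1) to (r + 1, s), and (k + 1) q_(k+1) =
    p q_k, used for k = r and k = s, turns the result into a multiple of q_r q_(s+1). *)
Lemma alt_sum_expq p r s :
  (r + s)%:R * alt_sum (expq p) r s = r%:R * (expq p r * expq p s).
Proof.
elim: s r => [|s IHs] r; first by rewrite alt_sum0 addn0.
rewrite alt_sumS mulrBr {2}addnS -addSn IHs.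
rewrite [X in _ - X]mulrA expqS addnS.
have -> : (r + s).+1%:R = r%:R + s.+1%:R :> K by rewrite -natrD addnS.
by rewrite mulrDl -addrA (mulrCA s.+1%:R) expqS; ring.
Qed.

Lemma seq_pf_schur_neq0 la : DP la ->
  seq_pf (fun r s => schur_entry r%:R s%:R : K) la != 0.
Proof.
move=> [la_sorted la0]; rewrite mulf_neq0 ?invr_eq0 ?natr_eq0_char0 //.
  by rewrite muln_eq0 expn_eq0 /= -lt0n fact_gt0.
have n_le : ((uphalf (size la)).*2 <= (size la).+1)%N.
  by rewrite uphalf_half doubleD; have := odd_double_half (size la); case: odd; lia.
(* The sequence stays strictly decreasing after the trailing 0 is added, because all parts are
   positive. *)
have x_lt (i j : 'I_(uphalf (size la)).*2) : (i < j)%N ->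
    (nth 0%N la j < nth 0%N la i)%N.
  move=> ij; have jla : (j <= size la)%N by rewrite -ltnS (leq_trans _ n_le).
  have ila := leq_trans ij jla.
  move: jla; rewrite leq_eqVlt => /predU1P[jE|jlt].
    rewrite [X in (X < _)%N]nth_default ?jE // lt0n.
    by apply: contraNneq la0 => <-; exact: mem_nth.
  have gtn_trans : transitive gtn by move=> a b c ab /ltn_trans; apply.
  exact: (sorted_ltn_nth gtn_trans 0%N la_sorted).
have x_inj (i j : 'I_(uphalf (size la)).*2) : nth 0%N la i = nth 0%N la j -> i = j.
  move=> e; apply: val_inj; have [/x_lt|/x_lt|//] := ltngtP i j; by rewrite e ltnn.
apply: (pf_sum_schur_neq0 char0 (x := fun i => (nth 0%N la i)%:R)).
  by move=> i j /natr_inj_char0/x_inj.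
move=> i j; apply: contraNneq => /eqP; rewrite -natrD natr_eq0_char0 addn_eq0.
by move=> /andP[/eqP i0 /eqP j0]; apply/eqP/x_inj; rewrite i0.
Qed.

Lemma schur_entry_double r s : schur_entry r.*2%:R s.*2%:R = schur_entry r%:R s%:R :> K.
Proof.
have n2 : 2%:R != 0 :> K by exact: (char0 1).
by rewrite /schur_entry -!muln2 !natrM -mulrBl -mulrDl -mulf_div divff ?mulr1.
Qed.

Lemma teval_delta1_schur_M r s : teval (delta1 K) (schur_M K r s) =
  expq 2%:R r * expq 2%:R s * schur_entry r%:R s%:R.
Proof.
rewrite (@teval_schur_M _ (expq 2%:R)) => [|k]; last first.
  rewrite (teval_schur_q (a := 0)) => [|i i0].
    by rewrite dvd1n divn1 /delta1 mulr1.
  by rewrite /delta1 eqSS double_eq0 (negPf i0).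
rewrite /schur_entry; case: ifP => [/andP[/eqP -> /eqP ->]|rs].
  by rewrite subrr mul0r mulr0.
have rs0 : r%:R + s%:R != 0 :> K by rewrite -natrD natr_eq0_char0 addn_eq0 rs.
apply: (mulfI rs0); rewrite mulrBr mulrCA -natrD alt_sum_expq natrD; field.
exact: rs0.
Qed.

(** * The specialization at delta_(k,3) / 3, with generating series exp(p z^3) *)

Definition expq3 (p : K) (k : nat) : K :=
  if (3 %| k)%N then expq p (k %/ 3) else 0.

Lemma expq3_mul p a : expq3 p (3 * a) = expq p a.
Proof. by rewrite /expq3 dvdn_mulr // mulKn. Qed.

Lemma expq3_eq0 p k : ~~ (3 %| k)%N -> expq3 p k = 0.
Proof. by rewrite /expq3 => /negPf ->. Qed.

(** The indices r + i and s - i add up to r + s, so they are never both divisible by 3. *)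
Lemma alt_sum_expq3_eq0 p r s : ~~ (3 %| r + s)%N -> alt_sum (expq3 p) r s = 0.
Proof.
move=> rs; rewrite /alt_sum big1 // => i _; have si := ltn_ord i.
have [ri|/expq3_eq0 ->] := boolP (3 %| r + i)%N; last by rewrite mul0r mulr0.
rewrite (@expq3_eq0 p (s - i)) ?mulr0 //; apply: contra rs => si3.
by rewrite -(subnKC (si : (i <= s)%N)) addnA dvdn_add.
Qed.

(** The recursion [alt_sumS] runs through the residue pairs cyclically: (0, 0) yields (2, 1), which
    yields (1, 2), which yields (0, 0) with b + 1. The term q_r q_s vanishes except in the last
    step. *)
Lemma alt_sum_expq3 p a b (e := expq p) :
  [/\ (a + b)%:R * alt_sum (expq3 p) (3 * a) (3 * b) = a%:R * (e a * e b),
      (a + b).+1%:R * alt_sum (expq3 p) (3 * a + 2) (3 * b + 1) = - (p * e a * e b)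
    & (a + b).+1%:R * alt_sum (expq3 p) (3 * a + 1) (3 * b + 2) = p * e a * e b].
Proof.
have step1 a' b' :
    (a'.+1 + b')%:R * alt_sum (expq3 p) (3 * a'.+1) (3 * b') =
      a'.+1%:R * (e a'.+1 * e b') ->
    (a' + b').+1%:R * alt_sum (expq3 p) (3 * a' + 2) (3 * b' + 1) =
      - (p * e a' * e b').
  move=> h; rewrite addn1 alt_sumS expq3_eq0; last by rewrite dvdn_addr ?dvdn_mulr.
  rewrite mul0r sub0r mulrN; congr (- _).
  have -> : (3 * a' + 2).+1 = (3 * a'.+1)%N by lia.
  by rewrite -addSn h mulrA expqS.
have step2 a' b' :
    (a' + b').+1%:R * alt_sum (expq3 p) (3 * a' + 2) (3 * b' + 1) =
      - (p * e a' * e b') ->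
    (a' + b').+1%:R * alt_sum (expq3 p) (3 * a' + 1) (3 * b' + 2) =
      p * e a' * e b'.
  move=> h; have -> : (3 * b' + 2 = (3 * b' + 1).+1)%N by lia.
  rewrite alt_sumS expq3_eq0; last by rewrite dvdn_addr ?dvdn_mulr.
  have -> : ((3 * a' + 1).+1 = 3 * a' + 2)%N by lia.
  by rewrite mul0r sub0r mulrN h opprK.
have A0 : forall a,
    (a + b)%:R * alt_sum (expq3 p) (3 * a) (3 * b) = a%:R * (e a * e b).
  elim: b {a} => [|b IHb] a.
    by rewrite muln0 alt_sum0 expq3_mul addn0 -(muln0 3) expq3_mul.
  have h := step2 _ _ (step1 _ _ (IHb a.+1)).
  have b3 : (3 * b.+1 = (3 * b + 2).+1)%N by lia.
  have a1 : ((3 * a).+1 = 3 * a + 1)%N by lia.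
  rewrite {1}b3 alt_sumS -b3 !expq3_mul a1 mulrBr addnS h -addnS natrD mulrDl.
  by rewrite (mulrCA b.+1%:R) expqS; rewrite /e; ring.
split; [exact: A0|exact/step1/A0|exact/step2/step1/A0].
Qed.

(* g in the header. *)
Definition residue_factor (r s : nat) : K :=
  match (r %% 3)%N, (s %% 3)%N with
  | 0, 0 => schur_entry r%:R s%:R
  | 1, 2 => 6%:R / (r + s)%:R
  | 2, 1 => - (6%:R / (r + s)%:R)
  | _, _ => 0
  end.

(* f in the header, with p = q_3, so that q_(3a) = p^a / a!. *)
Definition residue_exp (p : K) (k : nat) : K := p ^+ (k.+1 %/ 3) / (k %/ 3)`!%:R.

Definition delta3_exp : K := 2%:R * delta3_3 K 1.

(** For residues 1 and 2, with quotients a and b, M(r, s) is +-2 p^(a+b+1) / (a! b! (a + b + 1)).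
    Rounding (k + 1) / 3 down in [residue_exp] gives the extra p to residue 2, and r + s = 3 (a + b
    + 1) turns 2 into 6. *)
Lemma teval_delta3_schur_M r s : teval (delta3_3 K) (schur_M K r s) =
  residue_exp delta3_exp r * residue_exp delta3_exp s * residue_factor r s.
Proof.
rewrite (@teval_schur_M _ (expq3 delta3_exp)) => [|k]; last first.
  rewrite (teval_schur_q (a := 1)) // /expq3 => i i1.
  have -> : delta3_3 K i = (i == 1%N)%:R / 3%:R.
    by rewrite /delta3_3 (_ : (i.*2.+1 == 3)%N = (i == 1)%N) //; apply/eqP/eqP; lia.
  by rewrite (negPf i1) mul0r.
set p := delta3_exp; rewrite /residue_factor /residue_exp.
have mod3E a j : (j < 3)%N -> ((3 * a + j) %% 3 = j)%N.
  by move=> j3; rewrite mulnC modnMDl modn_small.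
have div3E a j : (j < 3)%N -> ((3 * a + j) %/ 3 = a)%N.
  by move=> j3; rewrite mulnC divnMDl // divn_small // addn0.
have zero : ~~ (3 %| r + s)%N -> (if (r == 0%N) && (s == 0%N) then 0 else
    2%:R * alt_sum (expq3 p) r s - expq3 p r * expq3 p s) = 0 :> K.
  move=> rs; case: ifP => // _; rewrite alt_sum_expq3_eq0 // mulr0 sub0r.
  have [r3|/expq3_eq0 ->] := boolP (3 %| r)%N; last by rewrite mul0r oppr0.
  by rewrite (@expq3_eq0 p s) ?mulr0 ?oppr0 //; apply: contra rs; exact: dvdn_add.
have rE := esym (divn_eq r 3); have sE := esym (divn_eq s 3).
have r3 := ltn_pmod r (isT : 0 < 3)%N; have s3 := ltn_pmod s (isT : 0 < 3)%N.
move: rE sE r3 s3 zero; rewrite 2!(mulnC _ 3).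
move: (r %/ 3)%N (r %% 3)%N (s %/ 3)%N (s %% 3)%N => a i b j <- <- i3 j3 zero.
have [h00 h21 h12] := alt_sum_expq3 p a b.
have ab0 : (a + b).+1%:R != 0 :> K by rewrite char0.
have n3 : 3%:R != 0 :> K by exact: (char0 2).
have S0 c : ((3 * c + 0).+1 %/ 3 = c)%N by lia.
have S1 c : ((3 * c + 1).+1 %/ 3 = c)%N by lia.
have S2 c : ((3 * c + 2).+1 %/ 3 = c.+1)%N by lia.
have e12 : (3 * a + 1 + (3 * b + 2) = 3 * (a + b).+1)%N by lia.
have e21 : (3 * a + 2 + (3 * b + 1) = 3 * (a + b).+1)%N by lia.
(* Six of the nine residue pairs have r + s not divisible by 3. *)
case: i i3 zero => [|[|[|//]]] _; case: j j3 => [|[|[|//]]] _ zero;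
  try by rewrite zero ?mulr0 //; lia.
- rewrite !S0 !addn0 !expq3_mul !muln_eq0 /= -/(expq p a) -/(expq p b).
  case: ifP => [/andP[/eqP -> /eqP ->]|ab].
    by rewrite !muln0 /schur_entry subrr mul0r mulr0.
  have ab1 : a%:R + b%:R != 0 :> K by rewrite -natrD natr_eq0_char0 addn_eq0 ab.
  apply: (mulfI ab1); rewrite mulrBr mulrCA -natrD h00 natrD /schur_entry !natrM.
  by field; rewrite -mulrDr mulf_neq0.
- rewrite S1 S2 e12 ifF; last by lia.
  apply: (mulfI ab0).
  rewrite mulrBr mulrCA h12 (@expq3_eq0 p (3 * a + 1)); last by lia.
  rewrite natrM /expq exprS; move: (_.+1%:R : K) ab0 => N N0; field.
  by rewrite n3 N0 !fact_neq0.
- rewrite S1 S2 e21 ifF; last by lia.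
  apply: (mulfI ab0).
  rewrite mulrBr mulrCA h21 (@expq3_eq0 p (3 * a + 2)); last by lia.
  rewrite natrM /expq exprS; move: (_.+1%:R : K) ab0 => N N0; field.
  by rewrite n3 N0 !fact_neq0.
Qed.

(** * Effect of doubling the parts *)

Definition double_sign (k : nat) : K := if (k %% 3 == 2)%N then - 2%:R^-1 else 1.

(** For residues 1 and 2, doubling flips the sign by swapping them and halves 6 / (r + s). The
    factor -1/2 is charged to residue 2, which occurs exactly once in such a pair. *)
Lemma residue_factor_double r s :
  residue_factor r.*2 s.*2 = double_sign r * double_sign s * residue_factor r s.
Proof.
have dblE k : (k.*2 %% 3 = (k %% 3).*2 %% 3)%N by rewrite -!muln2 modnMml.
have sumE : 6%:R / (r.*2 + s.*2)%:R = 2%:R^-1 * (6%:R / (r + s)%:R) :> K.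
  by rewrite -doubleD -muln2 natrM invfM; ring.
rewrite /residue_factor /double_sign (dblE r) (dblE s) schur_entry_double sumE.
have := ltn_pmod r (isT : 0 < 3)%N; have := ltn_pmod s (isT : 0 < 3)%N.
by case: (s %% 3)%N => [|[|[|]]] // _; case: (r %% 3)%N => [|[|[|]]] // _ /=; ring.
Qed.

Lemma seq_pf_scale_double M (F : nat -> K) la : F 0%N = 1 ->
    (forall r s, M r.*2 s.*2 = F r * F s * M r s) ->
  seq_pf M (map double la) = (\prod_(l <- la) F l) * seq_pf M la.
Proof. by move=> F0 FM; rewrite seq_pf_map_double; apply: seq_pf_scale. Qed.

(** H in the header. *)
Definition delta1_ratio (k : nat) : K := expq 2%:R k.*2 / expq 2%:R k.

(** F in the header, combining the contributions of g and f. *)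
Definition delta3_ratio (k : nat) : K :=
  double_sign k * (residue_exp delta3_exp k.*2 / residue_exp delta3_exp k).

Lemma delta1_ratio0 : delta1_ratio 0 = 1.
Proof. by rewrite /delta1_ratio double0 expq0 divr1. Qed.

Lemma delta1_ratio_neq0 k : delta1_ratio k != 0.
Proof. by rewrite mulf_neq0 ?invr_eq0 ?expq_neq0 ?(char0 1). Qed.

Lemma residue_exp_neq0 k : residue_exp delta3_exp k != 0.
Proof.
rewrite mulf_neq0 ?invr_eq0 ?fact_neq0 // expf_neq0 // mulf_neq0 ?(char0 1) //.
by rewrite /delta3_3 /= mul1r invr_eq0 (char0 2).
Qed.

Lemma delta3_ratio0 : delta3_ratio 0 = 1.
Proof. by rewrite /delta3_ratio double0 divff ?residue_exp_neq0 // mulr1. Qed.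

Lemma delta3_ratio_neq0 k : delta3_ratio k != 0.
Proof.
apply: mulf_neq0; last by rewrite mulf_neq0 ?invr_eq0 ?residue_exp_neq0.
by rewrite /double_sign; case: ifP; rewrite ?oner_neq0 // oppr_eq0 invr_eq0 (char0 1).
Qed.

Lemma teval_delta1_schur_Q_double la :
  teval (delta1 K) (schur_Q K (map double la)) =
    (\prod_(l <- la) delta1_ratio l) * teval (delta1 K) (schur_Q K la).
Proof.
apply: etrans (teval_schur_Q _ _) _.
apply: etrans (esym (congr1 _ (teval_schur_Q _ _))).
apply: seq_pf_scale_double => [|r s]; first exact: delta1_ratio0.
apply: etrans (teval_delta1_schur_M _ _) _.
apply: etrans (esym (congr1 _ (teval_delta1_schur_M _ _))).
rewrite schur_entry_double.
have r0 : expq 2%:R r != 0 by rewrite expq_neq0 ?(char0 1).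
have s0 : expq 2%:R s != 0 by rewrite expq_neq0 ?(char0 1).
rewrite /delta1_ratio; move: (schur_entry _ _) => x.
by move: (expq _ r) (expq _ s) r0 s0 => er es r0 s0; field; rewrite r0 s0.
Qed.

Lemma teval_delta3_schur_Q_double la :
  teval (delta3_3 K) (schur_Q K (map double la)) =
    (\prod_(l <- la) delta3_ratio l) * teval (delta3_3 K) (schur_Q K la).
Proof.
apply: etrans (teval_schur_Q _ _) _.
apply: etrans (esym (congr1 _ (teval_schur_Q _ _))).
apply: seq_pf_scale_double => [|r s]; first exact: delta3_ratio0.
apply: etrans (teval_delta3_schur_M _ _) _.
apply: etrans (esym (congr1 _ (teval_delta3_schur_M _ _))).
have r0 := residue_exp_neq0 r; have s0 := residue_exp_neq0 s.
rewrite residue_factor_double /delta3_ratio; move: (residue_factor r s) => x.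
move: (residue_exp _ r) (residue_exp _ s) r0 s0 => er es r0 s0; field.
by rewrite r0 s0.
Qed.

(** Once the nonzero factors q_l are taken out, Schur's Pfaffian in the parts remains. *)
Lemma teval_delta1_schur_Q_neq0 la : DP la ->
  teval (delta1 K) (schur_Q K la) != 0.
Proof.
move=> DPla; have -> : teval (delta1 K) (schur_Q K la) = (\prod_(l <- la) expq 2%:R l) *
    seq_pf (fun r s => schur_entry r%:R s%:R : K) la.
  apply: etrans (teval_schur_Q _ _) _.
  apply: seq_pf_scale; [exact: expq0|exact: teval_delta1_schur_M].
rewrite mulf_neq0 ?seq_pf_schur_neq0 // prodf_seq_neq0.
by apply/allP => l _; rewrite expq_neq0 ?(char0 1).
Qed.

(** * Comparison of the two series term by term *)

Lemma r_prod_telescope (g : nat -> K) la : g 0%N = 1 -> (forall k, g k != 0) ->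
  r_prod (fun j => g j / g j.-1) la = \prod_(l <- la) g l.
Proof.
move=> g0 gN0; apply: eq_bigr => l _; rewrite big_add1 /=.
have [->|l0] := posnP l; first by rewrite big_geq.
by rewrite (telescope_prodf (fun k _ => gN0 k) l0) g0 divr1.
Qed.

(** G in the header. *)
Definition MM_coef (u : K) (k : nat) : K := u ^+ k * (delta3_ratio k / delta1_ratio k).

(** For a given monomial, c stands for the power of 1/2 coming from [rescale] and X for the
    coefficient in Q_la. *)
Lemma MM_term_hypergeometric (u c X : K) la : u != 0 -> DP la ->
  c * (u ^+ sumn la * 2%:R ^- size la
    * (teval (delta1 K) (schur_Q K la)
       * teval (delta3_3 K) (schur_Q K (map double la))
       / teval (delta1 K) (schur_Q K (map double la))) * X) =
  2%:R ^- size la * r_prod (fun j => MM_coef u j / MM_coef u j.-1) la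
    * (c * X) * teval (delta3_3 K) (schur_Q K la).
Proof.
move=> u0 DPla; have Q0 := teval_delta1_schur_Q_neq0 DPla.
have E1 := teval_delta1_schur_Q_double la.
have E3 := teval_delta3_schur_Q_double la.
have P1 : \prod_(l <- la) delta1_ratio l != 0.
  by rewrite prodf_seq_neq0; apply/allP => l _; rewrite delta1_ratio_neq0.
rewrite r_prod_telescope; first last.
- move=> k; rewrite mulf_neq0 ?expf_neq0 // mulf_neq0 ?delta3_ratio_neq0 //.
  by rewrite invr_eq0 delta1_ratio_neq0.
- by rewrite /MM_coef expr0 delta3_ratio0 delta1_ratio0 divr1 mulr1.
have -> : \prod_(l <- la) MM_coef u l = u ^+ sumn la *
    ((\prod_(l <- la) delta3_ratio l) / \prod_(l <- la) delta1_ratio l).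
  rewrite big_split prodf_div /= sumnE; congr (_ * _).
  by rewrite -expr_sum.
(* Q_la(delta_(k,1)) cancels here, which requires it to be nonzero. *)
have cancel (P3 P1' Q Qd T Td : K) : P1' != 0 -> Q != 0 ->
    Qd = P1' * Q -> Td = P3 * T -> Q * Td / Qd = P3 / P1' * T.
  by move=> P10 QN0 -> ->; field; rewrite ?P10 ?QN0.
rewrite (cancel _ _ _ _ _ _ P1 Q0 E1 E3); ring.
Qed.

End Characteristic0.
End Evaluation.

Lemma hbarK_char0 (R : realType) n : n.+1%:R != 0 :> hbarK R.
Proof.
by rewrite -(rmorph_nat (@tofrac _)) tofrac_eq0 -polyC_natr polyC_eq0 pnatr_eq0.
Qed.

Lemma hbar16_cbrt_neq0 (R : realType) : hbar16_cbrt R != 0.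
Proof.
rewrite mulf_neq0 ?invr_eq0 ?tofrac_eq0 ?polyX_eq0 // polyC_eq0 rootC_eq0 //.
by rewrite pnatr_eq0.
Qed.

Theorem corollary3p5 (R : realType) :
  hypergeometric_BKP_tau (rescale 2%:R^-1 (tau_MM R)).
Proof.
pose u := hbar16_cbrt R.
(* The factor 2 compensates for the evaluation of Q_la at half of these constants. *)
exists (fun k => 2%:R * delta3_3 (hbarK R) k).
exists (fun j => MM_coef u j / MM_coef u j.-1) => m.
have n2 : 2%:R != 0 :> hbarK R by exact: hbarK_char0.
have tE : (fun k => 2%:R * delta3_3 (hbarK R) k / 2%:R) = delta3_3 (hbarK R).
  by apply: funext => k; rewrite mulrAC divff ?mul1r.
rewrite /rescale /tau_MM /DP_sum mulr_fsumr; apply: eq_fsbigr => la.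
move=> /classical_sets.set_mem DPla; rewrite /hypergeometric_term tE.
exact: (MM_term_hypergeometric (@hbarK_char0 R) _ _ (hbar16_cbrt_neq0 R) DPla).
Qed.
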